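(* Let $\alpha>0$, $p\in\mathbb{R}$. The (untransformed) series solution $$y=\Phi_\alpha(x)=\alpha\left(\frac{1-\tau}{\sigma}+u(\sigma,\tau)\right),\qquad \sigma=\frac{\alpha}{\ln x},\quad \tau=\alpha\,\frac{\ln\ln x}{\ln x},$$ of the equation $y^\alpha e^y=x$, and the corresponding transformed series for the Lambert $W$ function, $$W(z)=\ln z-\ln(p+\ln z)+u(\sigma,\tau),\qquad \sigma=\frac{1}{p+\ln z},\quad \tau=\frac{p+\ln(p+\ln z)}{p+\ln z},$$ are connected by the relations $$x=(\alpha z)^\alpha,\qquad \alpha=e^p.$$ That is, under these relations the variables $\sigma,\tau$ of the untransformed series become exactly the variables $\sigma,\tau$ of the transformed series, and $\Phi_\alpha(x)=\alpha W(z)$.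
   Context: $W=W_0$ is the principal branch of the Lambert $W$ function, defined by $We^W=z$. Variables are real with $x>1$, equivalently $p+\ln z>0$. In both cases $u=u(\sigma,\tau)$ is the same series in $\sigma,\tau$, which satisfies the fundamental relation $1-e^{-u}+\sigma u-\tau=0$: namely either $$u=\sum_{n=1}^\infty\sum_{m=1}^n(-1)^{n-m}\genfrac{[}{]}{0pt}{}{n}{n-m+1}\frac{\sigma^{n-m}\tau^m}{m!}$$ or $$u=\sum_{m=1}^\infty\sum_{q=0}^{m-1}\genfrac{\{}{\}}{0pt}{}{q+m-1}{q}_{\ge2}(-1)^{q+m-1}\frac{\zeta^{q+m}\tau^m}{m!},\quad \zeta=\frac{1}{1+\sigma}.$$ Here $\genfrac{[}{]}{0pt}{}{n}{k}$ is the Stirling cycle number (permutations of $n$ elements with $k$ cycles) and $\genfrac{\{}{\}}{0pt}{}{n}{k}_{\ge2}$ is the number of partitions of an $n$-set into $k$ blocks of size at least $2$. *)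

(* Defs.v *)
From Stdlib Require Import Reals Lra ClassicalEpsilon.
From Coquelicot Require Import Coquelicot.
From mathcomp Require Import all_boot all_fingroup.

Set Implicit Arguments.
Unset Strict Implicit.
Unset Printing Implicit Defensive.

Local Open Scope nat_scope.

Definition stirling_cycle (n k : nat) : nat :=
  #|[set s : 'S_n | #|porbits s| == k]|.

Definition stirling_partition_ge2 (n k : nat) : nat :=
  #|[set P : {set {set 'I_n}} |
      [&& partition P [set: 'I_n], #|P| == k & [forall B in P, 2 <= #|B|]]]|.

Local Open Scope R_scope.

(* On the real line the principal branch is the one with values in [-1, +oo);
   for z < -exp(-1) it has no real value and the chosen element is arbitrary. *)
Definition LambertW0 (z : R) : R :=
  epsilon (inhabits 0) (fun w => -1 <= w /\ w * exp w = z).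

Lemma LambertW0_spec (z : R) (hz : - exp (-1) <= z) :
  -1 <= LambertW0 z /\ LambertW0 z * exp (LambertW0 z) = z.
Proof.
apply: (epsilon_spec (inhabits 0) (fun w => -1 <= w /\ w * exp w = z)).
have Hc : continuity (fun w => w * exp w - z).
  move=> w; apply: derivable_continuous_pt; exists (exp w + w * exp w).
  by apply/is_derive_Reals; auto_derive => //; ring.
set b := Rmax z 0.
have hb0 : 0 <= b by apply: Rmax_r.
have hbz : z <= b by apply: Rmax_l.
have he := exp_ineq1_le b.
have hab : -1 <= b by lra.
have hs : (-1 * exp (-1) - z) * (b * exp b - z) <= 0.
  have : b * 1 <= b * exp b by apply: Rmult_le_compat_l; lra.
  by nra.
have [w [[h1 _] h2]] := IVT_cor _ (-1) b Hc hab hs.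
by exists w; split=> //; lra.
Qed.

Lemma LambertW0_unique (z w : R) (hw : -1 <= w) (hwz : w * exp w = z) :
  LambertW0 z = w.
Proof.
have mono a b : -1 <= a -> a < b -> a * exp a < b * exp b.
  move=> ha hab.
  have hd := exp_ineq1 (a - b) ltac:(lra).
  have hp := exp_pos b.
  have -> : exp a = exp (a - b) * exp b by rewrite -exp_plus; congr exp; lra.
  have h1 : 0 < exp (a - b) by apply: exp_pos.
  have h2 : exp (a - b) < 1 by rewrite -exp_0; apply: exp_increasing; lra.
  have h3 : exp (b - a) * exp (a - b) = 1
    by rewrite -exp_plus -exp_0; congr exp; lra.
  have h4 := exp_ineq1 (b - a) ltac:(lra).
  have h5 : a * exp (a - b) < b by nra.
  by nra.
have [h1 h2] := epsilon_spec (inhabits 0)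
  (fun v => -1 <= v /\ v * exp v = z) (ex_intro _ w (conj hw hwz)).
rewrite -/(LambertW0 z) in h1 h2.
case: (Rtotal_order (LambertW0 z) w) => [h|[//|h]].
- by have := mono _ _ h1 h; lra.
- by have := mono _ _ hw h; lra.
Qed.

Inductive expansion := cycle_expansion | partition_expansion.

(* The summand of index n >= 1 of the outer sum of the series u(sigma, tau);
   the inner sum is finite. *)
Definition u_term (e : expansion) (sigma tau : R) (n : nat) : R :=
  match e with
  | cycle_expansion =>
      sum_n_m (fun m : nat =>
        (-1) ^ (n - m) * INR (stirling_cycle n (n - m + 1))
        * (sigma ^ (n - m) * tau ^ m / INR m`!)) 1 n
  | partition_expansion =>
      let zeta := / (1 + sigma) in
      sum_n_m (fun q : nat =>
        INR (stirling_partition_ge2 (q + n - 1) q) * (-1) ^ (q + n - 1)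
        * (zeta ^ (q + n) * tau ^ n / INR n`!)) 0 (n - 1)
  end.

Definition u_converges (e : expansion) (sigma tau : R) : Prop :=
  ex_series (fun n => u_term e sigma tau n.+1).

(* Meaningful only under [u_converges]: [Series] is a total function. *)
Definition u (e : expansion) (sigma tau : R) : R :=
  Series (fun n => u_term e sigma tau n.+1).

Definition sigma_untransformed (alpha x : R) : R := alpha / ln x.

Definition tau_untransformed (alpha x : R) : R := alpha * (ln (ln x) / ln x).

Definition Phi (e : expansion) (alpha x : R) : R :=
  let sigma := sigma_untransformed alpha x in
  let tau := tau_untransformed alpha x in
  alpha * ((1 - tau) / sigma + u e sigma tau).

(* Positivity of y makes [Rpower y alpha] the genuine real power. *)
Definition solves_equation (alpha x y : R) : Prop :=
  0 < y /\ Rpower y alpha * exp y = x.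

Definition sigma_transformed (p z : R) : R := 1 / (p + ln z).

Definition tau_transformed (p z : R) : R :=
  (p + ln (p + ln z)) / (p + ln z).

Definition W_series (e : expansion) (p z : R) : R :=
  ln z - ln (p + ln z) + u e (sigma_transformed p z) (tau_transformed p z).

(* Main.v *)
Require Import Defs.
From Stdlib Require Import Reals.
From Coquelicot Require Import Coquelicot.
From Stdlib Require Import Lra.
From mathcomp Require Import all_boot all_fingroup all_algebra.
From mathcomp Require Import Rstruct ring zify.

(** Put l = p + ln z.  Since ln alpha = p, the relation x = (alpha z)^alpha says
    ln x = alpha l, so both pairs of variables are
    sigma = 1/l and tau = (p + ln l)/l, and (1 - tau)/sigma = ln z - ln l; this
    already gives Phi = alpha W as expressions.  What makes them solutions is
    the relation exp(-u) = 1 - tau + sigma u ([fundamental_relation]): it turns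
    w = ln z - ln l + u into w = l exp(-u), which is positive and satisfies
    w exp(w) = z, and then y = alpha w satisfies y^alpha exp(y) = x.

    The fundamental relation must follow from mere, possibly conditional,
    convergence of the outer series.  In both expansions the summand of index n
    is homogeneous of degree n, in (sigma, tau) or in tau alone: it is the
    coefficient a_n of t^n in the series u(t) obtained by scaling these
    variables by t.  Let e(t) be the right-hand side of the relation after the
    same scaling.  If e' = - u' e coefficientwise ([fps_exp_opp]), then on
    [0, 1), inside the disk of convergence, e exp(u) is constant, and Abel's
    theorem carries e = exp(-u) to t = 1 ([Series_exp_opp]).

    The coefficient identity W = 0, with W = t (e' + u' e), is where the Stirling
    numbers enter.  Consider the a_n as polynomials in one indeterminate X
    (tau, resp. zeta).  The recurrence of the Stirling numbers says exactly
    that a first-order operator L, a vector field in (t, X), maps u to t,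
    resp. to X t:
    L = (1 + sigma t) d/dX - t^2 d/dt for cycle numbers, and
    L = (1 - X t) t d/dt + t X^2 (1 - X) d/dX for partitions into blocks of
    size at least 2.  As e is affine in u, L e is a multiple of t e.  Commuting L
    with t d/dt gives a homogeneous linear equation for W
    ([fps_vf_wronskian]), whose only solution with the initial values of W is
    0 ([cycle_exp_opp], [partition_exp_opp]). *)

Set Implicit Arguments.
Unset Strict Implicit.
Unset Printing Implicit Defensive.
Import GRing.Theory Num.Theory.

(** * Formal power series and vector fields *)

Local Open Scope ring_scope.

(** Formal power series in t are sequences of coefficients; [fps_theta] is the
    Euler operator t d/dt and [fps_shift] is multiplication by t. *)
Definition fps_mul (A : pzSemiRingType) (f g : nat -> A) (n : nat) : A :=
  \sum_(k < n.+1) f k * g (n - k)%N.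

Definition fps_theta (A : pzSemiRingType) (f : nat -> A) (n : nat) : A :=
  n%:R * f n.

Definition fps_shift (A : pzSemiRingType) (f : nat -> A) (n : nat) : A :=
  if n is m.+1 then f m else 0.

(** The derivation p t d/dt + q d/dX of the series in t with coefficients in
    R[X]. *)
Definition fps_der (R : comNzRingType) (p q : {poly R}) (f : nat -> {poly R})
    (n : nat) : {poly R} :=
  p * fps_theta f n + q * (f n)^`().

(** The vector field (p t d/dt + q d/dX) + t (r t d/dt + s d/dX).  Allowing one
    factor t covers the fields of both expansions and keeps every equation a
    two-term recurrence on coefficients. *)
Definition fps_vf (R : comNzRingType) (p q r s : {poly R})
    (f : nat -> {poly R}) (n : nat) : {poly R} :=
  fps_der p q f n + fps_shift (fps_der r s f) n.

Lemma fps_mul_ext (A : pzSemiRingType) (f f' g g' : nat -> A) n :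
  f =1 f' -> g =1 g' -> fps_mul f g n = fps_mul f' g' n.
Proof. by move=> ef eg; apply: eq_bigr => i _; rewrite ef eg. Qed.

Lemma fps_mulDl (A : pzSemiRingType) (f f' g : nat -> A) n :
  fps_mul (fun k => f k + f' k) g n = fps_mul f g n + fps_mul f' g n.
Proof. by rewrite -big_split; apply: eq_bigr => i _; rewrite mulrDl. Qed.

Lemma fps_mulDr (A : pzSemiRingType) (f g g' : nat -> A) n :
  fps_mul f (fun k => g k + g' k) n = fps_mul f g n + fps_mul f g' n.
Proof. by rewrite -big_split; apply: eq_bigr => i _; rewrite mulrDr. Qed.

Lemma fps_mulZr (A : comPzSemiRingType) (c : A) (f g : nat -> A) n :
  fps_mul f (fun k => c * g k) n = c * fps_mul f g n.
Proof. by rewrite big_distrr; apply: eq_bigr => i _ /=; rewrite mulrCA. Qed.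

Lemma fps_mul_shiftl (A : pzSemiRingType) (f g : nat -> A) n :
  fps_mul (fps_shift f) g n = fps_shift (fps_mul f g) n.
Proof.
case: n => [|n]; rewrite /fps_mul big_ord_recl /= mul0r add0r.
  by rewrite big_ord0.
by apply: eq_bigr => i _; rewrite subSS.
Qed.

Lemma fps_mul_shiftr (A : pzSemiRingType) (f g : nat -> A) n :
  fps_mul f (fps_shift g) n = fps_shift (fps_mul f g) n.
Proof.
case: n => [|n]; rewrite /fps_mul big_ord_recr /=.
  by rewrite big_ord0 mulr0 addr0.
rewrite subnn mulr0 addr0; apply: eq_bigr => i _.
by rewrite subSn //; case: i => i /=; rewrite ltnS.
Qed.

Lemma fps_der_mul (R : comNzRingType) (p q : {poly R}) f g n :
  fps_der p q (fps_mul f g) n =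
  fps_mul (fps_der p q f) g n + fps_mul f (fps_der p q g) n.
Proof.
rewrite /fps_der /fps_theta /fps_mul raddf_sum /= !big_distrr -!big_split.
apply: eq_bigr => i _ /=; rewrite derivM.
have /(congr1 (fun k => k%:R : {poly R})) : n = (i + (n - i))%N.
  by rewrite subnKC // -ltnS.
rewrite natrD => ->; ring.
Qed.

Lemma fps_vf_mul (R : comNzRingType) (p q r s : {poly R}) f g n :
  fps_vf p q r s (fps_mul f g) n =
  fps_mul (fps_vf p q r s f) g n + fps_mul f (fps_vf p q r s g) n.
Proof.
rewrite /fps_vf fps_mulDl fps_mulDr fps_mul_shiftl fps_mul_shiftr fps_der_mul.
case: n => [|n] /=; first by rewrite !addr0.
rewrite fps_der_mul; ring.
Qed.

(** With L = A + t B and T = t d/dt, the derivations A and B commute with T and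
    T t = t (T + 1), so [L, T] = - t B = A - L. *)
Lemma fps_vf_theta (R : comNzRingType) (p q r s : {poly R}) f n :
  fps_vf p q r s (fps_theta f) n =
  fps_theta (fps_vf p q r s f) n - fps_vf p q r s f n + fps_der p q f n.
Proof.
rewrite /fps_vf /fps_theta /fps_der /fps_theta.
have dn (m k : nat) : ((m%:R : {poly R}) * f k)^`() = m%:R * (f k)^`().
  by rewrite !mulr_natl derivMn.
case: n => [|n] /=; first by rewrite !dn; ring.
rewrite !dn -[n.+1]addn1 natrD; ring.
Qed.

(** If L U = c t and L E = - d t E, the commutator of L with T = t d/dt gives
    L (T U) = A U and L (T E) = A E - d t T E.  Hence W = T E + (T U) E, whose
    vanishing expresses that E is proportional to exp(-U), satisfies
    L W = W_A - d t W, with W_A = A E + (A U) E built in the same way from the derivation A. *)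
Lemma fps_vf_wronskian (R : comNzRingType) (p q r s c d : {poly R}) U E :
    (forall n, fps_vf p q r s U n = if n == 1%N then c else 0) ->
    (forall n, fps_vf p q r s E n = - d * fps_shift E n) ->
  forall n,
  fps_vf p q r s (fun k => fps_theta E k + fps_mul (fps_theta U) E k) n =
  fps_der p q E n + fps_mul (fps_der p q U) E n
  - d * fps_shift (fun k => fps_theta E k + fps_mul (fps_theta U) E k) n.
Proof.
move=> hU hE n.
have LD f g m : fps_vf p q r s (fun k => f k + g k) m =
    fps_vf p q r s f m + fps_vf p q r s g m.
  rewrite /fps_vf /fps_der /fps_theta; case: m => [|m] /=; rewrite !derivD;
    ring.
rewrite LD fps_vf_mul fps_vf_theta.
have -> : fps_mul (fps_vf p q r s (fps_theta U)) E n =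
    fps_mul (fps_der p q U) E n.
  apply: fps_mul_ext => // k; rewrite fps_vf_theta /fps_theta hU.
  by case: k => [|[|k]] /=; rewrite ?eqSS /=; ring.
have -> : fps_mul (fps_theta U) (fps_vf p q r s E) n =
    - d * fps_shift (fps_mul (fps_theta U) E) n.
  by rewrite -fps_mul_shiftr -fps_mulZr; apply: fps_mul_ext.
rewrite /fps_theta !hE; case: n => [|n] /=; first by ring.
rewrite -[n.+1]addn1 natrD; ring.
Qed.

Lemma poly_deriv_eq0 (R : numDomainType) (p : {poly R}) :
  p^`() = 0 -> p.[0] = 0 -> p = 0.
Proof.
move=> dp p0; apply/polyP => -[|n]; rewrite coef0;
  first by rewrite -horner_coef0.
by have /eqP := coef_deriv p n; rewrite dp coef0 eq_sym mulrn_eq0 => /eqP.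
Qed.

(** The equation t e' = - t a' e, which for a = O(t) says e = e(0) exp(-a).  It
    avoids composing formal series and is what the real analysis consumes. *)
Definition fps_exp_opp (A : pzSemiRingType) (a e : nat -> A) : Prop :=
  forall n, fps_theta e n + fps_mul (fps_theta a) e n = 0.

Lemma fps_mul_horner (R : comNzRingType) (f g : nat -> {poly R}) (x : R) n :
  (fps_mul f g n).[x] = fps_mul (fun k => (f k).[x]) (fun k => (g k).[x]) n.
Proof. by rewrite horner_sum; apply: eq_bigr => i _; rewrite hornerM. Qed.

Lemma fps_mul_1r (A : pzSemiRingType) (f g : nat -> A) n :
  (forall k, g k = (k == 0%N)%:R) -> fps_mul f g n = f n.
Proof.
move=> hg; rewrite /fps_mul big_ord_recr /= subnn hg mulr1 big1 ?add0r // =>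
  i _.
by rewrite hg subn_eq0 leqNgt ltn_ord mulr0.
Qed.

(** The equation L f = - t f, with L = (1 + sigma t) d/dX - t^2 d/dt, expresses the
    X-derivative of each coefficient through the preceding coefficient, so the
    values at X = 0 determine f. *)
Lemma fps_vf_translation_eq0 (R : numDomainType) (sigma : {poly R})
    (f : nat -> {poly R}) :
    (forall n, (f n).[0] = 0) ->
    (forall n, fps_vf 0 1 (-1) sigma f n = - fps_shift f n) ->
  forall n, f n = 0.
Proof.
move=> f0 Lf; elim=> [|n IH]; apply: poly_deriv_eq0 (f0 _).
  by have := Lf 0%N; rewrite /fps_vf /fps_der /= mul0r mul1r add0r addr0 oppr0.
have := Lf n.+1; rewrite /fps_vf /fps_der /fps_theta /= IH deriv0.
by rewrite mul0r mul1r !mulr0 !addr0 add0r oppr0.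
Qed.

(** Here X is tau, the recurrence says L U = t, and e = 1 - X t + sigma t U
    satisfies L e = - t e.  The operator A of [fps_vf_wronskian] is d/dX, which
    commutes with L, so V = W_A solves the homogeneous equation L V = - t V and
    vanishes; then W solves the same equation. *)
Lemma cycle_exp_opp (R : numDomainType) (sigma : R) (a : nat -> {poly R}) :
    a 0%N = 0 -> (forall n, (a n).[0] = 0) ->
    (forall n, (a n.+1)^`() =
       n%:R * a n - sigma%:P * (a n)^`() + (n == 0%N)%:R) ->
  fps_exp_opp a (fun n => (n == 0%N)%:R - (n == 1%N)%:R * 'X
                          + sigma%:P * fps_shift a n).
Proof.
move=> a0 an0 da; set e := fun _ => _; rewrite /fps_exp_opp.
have e0 : e 0%N = 1 by rewrite /e /=; ring.
have e1 : e 1%N = - 'X by rewrite /e /= a0; ring.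
have e2 n : e n.+2 = sigma%:P * a n.+1 by rewrite /e /=; ring.
have en0 k : (e k).[0] = (k == 0%N)%:R.
  case: k => [|[|k]]; rewrite ?e0 ?e1 ?e2 ?hornerE ?oppr0 //=.
  by rewrite an0 mulr0.
have LU n : fps_vf 0 1 (-1) sigma%:P a n = if n == 1%N then 1 else 0.
  rewrite /fps_vf /fps_der /fps_theta.
  case: n => [|n] /=; first by rewrite a0 deriv0; ring.
  by rewrite da eqSS; case: n => [|n] /=; ring.
have LE n : fps_vf 0 1 (-1) sigma%:P e n = -1 * fps_shift e n.
  rewrite /fps_vf /fps_der /fps_theta.
  case: n => [|[|[|n]]] /=.
  - by rewrite e0 derivC; ring.
  - by rewrite e1 e0 derivC derivN derivX; ring.
  - rewrite e2 e1 derivM derivC da a0 deriv0 derivN derivX /=; ring.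
  - rewrite !e2 !derivM derivC da /= -[n.+2]addn1 natrD; ring.
set W := fun n => fps_theta e n + fps_mul (fps_theta a) e n.
pose V n := fps_der 0 1 e n + fps_mul (fps_der 0 1 a) e n.
have LW n : fps_vf 0 1 (-1) sigma%:P W n = V n - 1 * fps_shift W n.
  exact: fps_vf_wronskian LU LE n.
have V0 n : V n = 0.
  have D1 f k : fps_der 0 1 f k = (f k)^`() :> {poly R} by rewrite /fps_der;
    ring.
  apply: (@fps_vf_translation_eq0 _ sigma%:P) n => n.
    rewrite /V hornerD fps_mul_horner fps_mul_1r // !D1.
    case: n => [|n]; first by rewrite e0 a0 derivC deriv0 horner0 addr0.
    rewrite da; case: n => [|n];
      rewrite ?e1 ?e2 ?derivN ?derivX ?derivM ?derivC ?da.
      by rewrite a0 deriv0 !mulr0 subr0 add0r -hornerD addNr horner0.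
    rewrite -hornerD; transitivity (n.+1%:R * a n.+1).[0]; last first.
      by rewrite hornerM an0 mulr0.
    congr (_.[0]); rewrite /=; ring.
  have -> : fps_vf 0 1 (-1) sigma%:P V n =
      fps_vf 0 1 (-1) sigma%:P (fps_der 0 1 e) n
      + fps_vf 0 1 (-1) sigma%:P (fps_mul (fps_der 0 1 a) e) n.
    rewrite /V /fps_vf /fps_der /fps_theta; case: n => [|n] /=;
      rewrite ?derivD; ring.
  have LD f k : fps_vf 0 1 (-1) sigma%:P (fps_der 0 1 f) k =
      (fps_vf 0 1 (-1) sigma%:P f k)^`().
    rewrite /fps_vf /fps_der /fps_theta; case: k => [|k] /=;
    by rewrite ?(derivD, derivM, derivN, derivC, derivMn) ?deriv0; ring.
  rewrite fps_vf_mul LD LE.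
  have -> : fps_mul (fps_vf 0 1 (-1) sigma%:P (fps_der 0 1 a)) e n = 0.
    rewrite /fps_mul big1 // => i _; rewrite LD LU.
    by case: ifP; rewrite ?derivC ?deriv0 mul0r.
  have -> : fps_mul (fps_der 0 1 a) (fps_vf 0 1 (-1) sigma%:P e) n =
      -1 * fps_shift (fps_mul (fps_der 0 1 a) e) n.
    by rewrite -fps_mul_shiftr -fps_mulZr; apply: fps_mul_ext.
  case: n => [|n] /=; first by rewrite mulr0 deriv0; ring.
  rewrite /V D1 mulN1r derivN; ring.
apply: (@fps_vf_translation_eq0 _ sigma%:P) => n.
  rewrite /W hornerD fps_mul_horner fps_mul_1r // /fps_theta !hornerM an0 en0.
  by case: n => [|n]; rewrite ?mulr0n ?horner0 /=; ring.
by rewrite LW V0 mul1r add0r.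
Qed.

(** Here X is zeta = 1/(1 + sigma), the recurrence says L U = X t, and A is t d/dt
    itself, so [fps_vf_wronskian] reads L W = W - X^2 t W.  The series
    e = X (1 - t) + (1 - X) U is zeta times 1 - t + sigma U: the factor clears the
    denominator of sigma = 1/X - 1. *)
Lemma partition_exp_opp (R : numDomainType) (a : nat -> {poly R}) :
    a 0%N = 0 -> a 1%N = 'X ->
    (forall n, n.+2%:R * a n.+2 =
       n.+1%:R * 'X * a n.+1 - 'X^2 * (1 - 'X) * (a n.+1)^`()) ->
  fps_exp_opp a (fun n => (n == 0%N)%:R * 'X - (n == 1%N)%:R * 'X
                          + (1 - 'X) * a n).
Proof.
move=> a0 a1 ra; set e := fun _ => _; rewrite /fps_exp_opp.
have e0 : e 0%N = 'X by rewrite /e /= a0; ring.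
have e1 : e 1%N = - 'X^2 by rewrite /e /= a1; ring.
have e2 n : e n.+2 = (1 - 'X) * a n.+2 by rewrite /e /=; ring.
set s : {poly R} := 'X^2 * (1 - 'X).
have LU n : fps_vf 1 0 (- 'X) s a n = if n == 1%N then 'X else 0.
  rewrite /fps_vf /fps_der /fps_theta.
  case: n => [|[|n]] /=; first by ring.
    by rewrite a0 a1 deriv0; ring.
  rewrite ra /s; ring.
have LE n : fps_vf 1 0 (- 'X) s e n = - 'X^2 * fps_shift e n.
  rewrite /fps_vf /fps_der /fps_theta.
  case: n => [|[|[|n]]] /=.
  - by ring.
  - by rewrite e1 e0 derivX /s; ring.
  - rewrite e2 e1 derivN derivXn /= mul1r mul0r addr0 mulrCA ra a1 derivX /s;
    ring.
  - rewrite !e2 mul1r mul0r addr0 mulrCA ra derivM derivB derivX derivC /s;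
    ring.
set W := fun n => fps_theta e n + fps_mul (fps_theta a) e n.
have LW n : fps_vf 1 0 (- 'X) s W n = W n - 'X^2 * fps_shift W n.
  rewrite (fps_vf_wronskian LU LE n); congr (_ - _).
  have D f k : fps_der 1 0 f k = fps_theta f k :> {poly R} by rewrite /fps_der;
    ring.
  by rewrite D; congr (_ + _); apply: fps_mul_ext.
elim=> [|n IH].
  by rewrite /fps_theta /fps_mul big_ord1 a0; ring.
(* As W_n = 0, in degree n + 1 the equation L W = W - X^2 t W reads
   (n + 1) W_(n+1) = W_(n+1): it gives no information in degree 1, where
   W is computed. *)
have := LW n.+1; rewrite /fps_vf /fps_der /fps_theta /= [W n]IH deriv0.
rewrite !mulr0 !addr0 mul1r mul0r addr0 subr0.
case: n {IH} => [|n].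
  move=> _; rewrite /W /fps_theta /fps_mul !big_ord_recl big_ord0 /= e0 e1 a0
    a1.
  have -> : bump 0 0 = 1%N by [].
  by ring.
rewrite -{1}[n.+2]addn1 natrD mulrDl mul1r -[RHS]add0r => /addIr/eqP.
by rewrite mulf_eq0 -polyC_natr polyC_eq0 pnatr_eq0 /= => /eqP.
Qed.

Local Close Scope ring_scope.

(** * Recurrences for the Stirling numbers *)

Local Open Scope nat_scope.

Lemma card_porbits_lift_perm n (s : 'S_n) :
  #|porbits (lift_perm ord_max ord_max s)| = #|porbits s|.+1.
Proof.
set t := lift_perm _ _ s; pose l : 'I_n -> 'I_n.+1 := lift ord_max.
have tX i j : (t ^+ i)%g (l j) = l ((s ^+ i)%g j).
  by elim: i => [|i IH];
    rewrite ?expg0 ?perm1 // !expgSr !permM IH lift_perm_lift.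
have tm i : (t ^+ i)%g ord_max = ord_max.
  by elim: i => [|i IH]; rewrite ?expg0 ?perm1 // expgSr permM IH lift_perm_id.
have ol j : porbit t (l j) = l @: porbit s j.
  apply/setP => y; apply/porbitP/imsetP => [[i ->]|[z /porbitP[i ->] ->]].
    by exists ((s ^+ i)%g j); rewrite ?tX // mem_porbit.
  by exists i; rewrite tX.
have om : porbit t ord_max = [set ord_max].
  by apply/setP => y; rewrite inE; apply/porbitP/eqP => [[i ->]|->];
    [|exists 0];
    rewrite ?tm.
have -> : porbits t =
    [set ord_max] |: [set l @: (B : {set _}) | B in porbits s].
  apply/setP => X; rewrite !inE; apply/imsetP/orP => [[y _ ->]|].
    case: (unliftP ord_max y) => [j|] ->; last by left; rewrite om.
    by right; apply/imsetP; exists (porbit s j); rewrite ?imset_f // ol.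
  case=> [/eqP ->|/imsetP[_ /imsetP[j _ ->] ->]]; first by exists ord_max.
  by exists (l j); rewrite // ol.
rewrite cardsU1 card_imset; last exact/imset_inj/lift_inj.
rewrite (_ : _ \notin _) ?add1n //; apply/imsetP => -[B _ /setP/(_ ord_max)].
by rewrite inE eqxx => /esym/imsetP[j _ /eqP]; rewrite eq_liftF.
Qed.

(** Composing with a transposition that moves the fixed point inserts it into
    the cycle of i, which undoes the extra cycle. *)
Lemma card_porbits_insert n (i : 'I_n.+1) (s : 'S_n) :
  #|porbits (tperm ord_max i * lift_perm ord_max ord_max s)%g| =
  #|porbits s| + (i == ord_max).
Proof.
have [->|ni] := eqVneq i ord_max.
  by rewrite tperm1 mul1g card_porbits_lift_perm addn1.
have := porbits_mul_tperm (lift_perm ord_max ord_max s) ord_max i.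
rewrite card_porbits_lift_perm [ord_max == i]eq_sym ni /= porbit_sym.
suff -> : i \notin porbit (lift_perm ord_max ord_max s) ord_max.
  by rewrite addn1 addn0 addnC => -[].
apply/porbitP => -[m im]; case/eqP: ni; rewrite im.
by elim: m {im} => [|m IH];
  rewrite ?expg0 ?perm1 // expgSr permM IH lift_perm_id.
Qed.

(** Every permutation of n + 1 points arises once by inserting the last point,
    either as a fixed point or next to one of the n others. *)
Lemma stirling_cycle_rec n k :
  stirling_cycle n.+1 k.+1 = n * stirling_cycle n k.+1 + stirling_cycle n k.
Proof.
pose h (u : 'I_n.+1 * 'S_n) : 'S_n.+1 :=
  (tperm ord_max u.1 * lift_perm ord_max ord_max u.2)%g.
have h_inj : injective h.
  move=> [i s] [j t] /= e.
  have hi u : h u u.1 = ord_max by rewrite /h permM tpermR lift_perm_id.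
  have ij : i = j.
    by apply: (@perm_inj _ (h (i, s))); rewrite (hi (i, s)) e (hi (j, t)).
  move: e; rewrite /h /= -ij => /mulgI e; congr (_, _); apply/permP => m.
  by apply: (@lift_inj _ ord_max); rewrite -!(lift_perm_lift ord_max ord_max) e.
have h_bij : bijective h.
  by apply: inj_card_bij h_inj _; rewrite card_prod card_ord !card_Sn factS.
rewrite /stirling_cycle -!sum1dep_card (reindex h) /=; last exact: onW_bij.
under eq_bigl => u do rewrite card_porbits_insert.
rewrite -(pair_big_dep xpredT
  (fun i s => #|porbits s| + (i == ord_max) == k.+1) (fun _ _ => 1)) /=.
rewrite big_ord_recr /= eqxx; congr (_ + _); last by apply: eq_bigl => s;
  rewrite addn1.
rewrite -[X in X * _](card_ord n) -sum_nat_const; apply: eq_bigr => i _ /=.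
by apply: eq_bigl => s; rewrite -val_eqE /= (ltn_eqF (ltn_ord i)) addn0.
Qed.

Lemma stirling_cycle_gt n k : n < k -> stirling_cycle n k = 0.
Proof.
move=> nk; apply/eqP; rewrite cards_eq0; apply/eqP/setP => s; rewrite !inE.
apply/eqP => e; move: nk;
  rewrite -e ltnNge /porbits (leq_trans (leq_imset_card _ _)) //.
by rewrite card_ord.
Qed.

Lemma stirling_cycle0 n : stirling_cycle n 0 = (n == 0).
Proof.
case: n => [|n] /=.
  rewrite /stirling_cycle (_ : [set _ | _] = setT) ?cardsT ?card_Sn //.
  by apply/setP => s; rewrite !inE cards_eq0 -subset0;
    apply/subsetP => B /imsetP[[]].
apply/eqP; rewrite cards_eq0; apply/eqP/setP => s; rewrite !inE cards_eq0.
by apply/eqP => /setP/(_ (porbit s ord0)); rewrite imset_f // inE.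
Qed.

Definition partitions_ge2 (T : finType) (D : {set T}) (k : nat) :
    {set {set {set T}}} :=
  [set P | [&& partition P D, #|P| == k & [forall B in P, 2 <= #|B|]]].

(** Partitions containing the block {x, y} are counted by deleting that
    block. *)
Lemma partitions_ge2_pair (T : finType) (D : {set T}) k x y :
    x \notin D -> y \in D ->
  #|[set P in partitions_ge2 (x |: D) k.+1 | [set x; y] \in P]| =
  #|partitions_ge2 (D :\ y) k|.
Proof.
move=> xD yD; set B := [set x; y].
have neB : B != set0 by apply/set0Pn; exists x; rewrite set21.
have cB : #|B| = 2 by rewrite cards2 (contraNneq _ xD) // => ->.
have dB : [disjoint B & D :\ y].
  rewrite -setI_eq0; apply/eqP/setP => z; rewrite !inE.
  by case: eqP => [->|_] /=; [rewrite (negbTE xD) andbF|case: eqP].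
have BD : B :|: D :\ y = x |: D.
  by rewrite /B -setUA setD1K.
have DB : (x |: D) :\: B = D :\ y.
  by rewrite -BD setDUl setDv set0U; apply/setDidPl; rewrite disjoint_sym.
have notB Q : partition Q (D :\ y) -> B \notin Q.
  move=> pQ; apply/negP => BQ; have /subsetP/(_ x) := partitionS pQ BQ.
  by rewrite set21 !inE (negbTE xD) andbF => /(_ isT).
rewrite -[RHS](card_in_imset (f := fun Q => B |: Q)); last first.
  move=> Q Q'; rewrite !inE => /and3P[/notB nQ _ _] /and3P[/notB nQ' _ _] e.
  by rewrite -(setU1K nQ) e setU1K.
apply: eq_card => P; rewrite !inE; apply/andP/imsetP.
  move=> [/and3P[pP /eqP cP /forall_inP gP] BP]; exists (P :\ B);
    last by rewrite setD1K.
  rewrite inE -DB partitionD1 //=; have := cardsD1 B P;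
    rewrite BP cP add1n => -[<-].
  by rewrite eqxx; apply/forall_inP => C /setD1P[_]; apply: gP.
move=> [Q]; rewrite inE => /and3P[pQ /eqP cQ /forall_inP gQ] ->; rewrite setU11.
split=> //; rewrite -BD partitionU1 // cardsU1 notB // cQ eqxx /=.
by apply/forall_inP => C /setU1P[->|/gQ //]; rewrite cB.
Qed.

(** If the block of x has at least three elements, deleting x leaves a
    partition of D with the same number of blocks and one distinguished block:
    the pairs (Q, B) below. *)
Lemma partitions_ge2_large (T : finType) (D : {set T}) k x :
    x \notin D ->
  #|[set P in partitions_ge2 (x |: D) k | 2 < #|pblock P x| ]| =
  k * #|partitions_ge2 D k|.
Proof.
move=> xD.
pose S := [set u : {set {set T}} * {set T} |
  (u.1 \in partitions_ge2 D k) && (u.2 \in u.1)].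
pose h (u : {set {set T}} * {set T}) := (x |: u.2) |: (u.1 :\ u.2).
have cS : #|S| = k * #|partitions_ge2 D k|.
  rewrite mulnC -sum1dep_card.
  rewrite -(pair_big_dep (mem (partitions_ge2 D k))
    (fun Q B => B \in Q) (fun _ _ => 1)) /=.
  rewrite -sum_nat_const; apply: eq_bigr => Q; rewrite inE sum1_card.
  by case/and3P => _ /eqP.
have xB Q B : partition Q D -> B \in Q -> x \notin B.
  by move=> pQ BQ; apply: contra xD; apply/subsetP/(partitionS pQ BQ).
have ph Q B : partition Q D -> B \in Q -> partition (h (Q, B)) (x |: D).
  move=> pQ BQ; rewrite /h /=.
  have -> : x |: D = (x |: B) :|: (D :\: B).
    rewrite -setUA; congr (_ |: _); apply/setP => z; rewrite !inE.
    by have := subsetP (partitionS pQ BQ) z; case: (z \in B) => // ->.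
  apply: partitionU1 (partitionD1 pQ BQ) _ _; first by apply/set0Pn; exists x;
    rewrite setU11.
  rewrite -setI_eq0; apply/eqP/setP => z; rewrite !inE.
  by case: eqP => [->|_] /=; [rewrite (negbTE xD) andbF|case: (z \in B)].
have nxB Q B : partition Q D -> B \in Q -> x |: B \notin Q.
  by move=> pQ BQ; apply/negP => /(xB _ _ pQ); rewrite setU11.
have bh Q B : partition Q D -> B \in Q -> pblock (h (Q, B)) x = x |: B.
  move=> pQ BQ; apply: def_pblock; rewrite ?setU11 //.
  exact: partition_trivIset (ph _ _ pQ BQ).
rewrite -cS -[RHS](card_in_imset (f := h)); last first.
  move=> [Q B] [Q' B']; rewrite !inE /= =>
    /andP[/and3P[pQ _ _] BQ] /andP[/and3P[pQ' _ _] BQ'] e.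
  have eB : B = B'.
    by rewrite -(setU1K (xB _ _ pQ BQ)) -(bh _ _ pQ BQ) e bh //
      setU1K // (xB _ _ pQ').
  congr (_, _); last by [].
  rewrite -(setD1K BQ) -(setD1K BQ') -eB; congr (_ |: _).
  have n1 : x |: B \notin Q :\ B by rewrite inE negb_and (nxB _ _ pQ) ?orbT.
  have n2 : x |: B \notin Q' :\ B by rewrite inE negb_and (nxB _ _ pQ') ?orbT
    // eB.
  by rewrite -(setU1K n1) -(setU1K n2); move: e; rewrite /h /= -eB => ->.
apply: eq_card => P; apply/idP/imsetP.
  rewrite !inE => /andP[/and3P[pP /eqP cP /forall_inP gP] lP].
  have xP : x \in cover P by rewrite (cover_partition pP) setU11.
  have PxP := pblock_mem xP; have xPx : x \in pblock P x by rewrite mem_pblock.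
  set C := pblock P x in lP PxP xPx.
  have cC : #|C :\ x|.+1 = #|C| by rewrite [RHS](cardsD1 x) xPx.
  have nC : C :\ x \notin P :\ C.
    apply/negP => /setD1P[ne CP].
    have /trivIsetP/(_ _ _ CP PxP ne) := partition_trivIset pP.
    rewrite -setI_eq0 (setIidPl (subD1set _ _)) -cards_eq0 => /eqP c0.
    by move: lP; rewrite -cC c0.
  exists (C :\ x |: P :\ C, C :\ x);
    last by rewrite /h /= setD1K // setU1K // setD1K.
  rewrite !inE eqxx andbT; apply/and3P; split.
  - have -> : D = (C :\ x) :|: ((x |: D) :\: C).
      apply/setP => z; rewrite !inE; have := subsetP (partitionS pP PxP) z;
        rewrite !inE.
      by case: eqP => [->|_] /=; rewrite ?xPx /=;
        [rewrite (negbTE xD)|case: (z \in C) => //= ->].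
    apply: partitionU1 (partitionD1 pP PxP) _ _.
      by rewrite -card_gt0 -ltnS cC ltnW.
    rewrite -setI_eq0; apply/eqP/setP => z; rewrite !inE.
    by case: (z \in C); rewrite ?andbF.
  - by rewrite cardsU1 nC -cP (cardsD1 C P) PxP.
  - apply/forall_inP => E /setU1P[->|/setD1P[_ /gP //]].
    by rewrite -ltnS cC.
move=> [[Q B]]; rewrite !inE /= =>
  /andP[/and3P[pQ /eqP cQ /forall_inP gQ] BQ] ->.
rewrite bh // ph // cardsU1 (xB _ _ pQ BQ) ltnS gQ // andbT.
rewrite /h /= cardsU1 !inE negb_and (nxB _ _ pQ BQ) orbT.
have := cardsD1 B Q; rewrite BQ cQ => <-; rewrite eqxx /=.
apply/forall_inP => E /setU1P[->|/setD1P[_ /gQ //]].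
by rewrite cardsU1 (xB _ _ pQ BQ) add1n ltnW // ltnS gQ.
Qed.

(** The block of x is either a pair {x, y} with y in D or has at least three
    elements. *)
Lemma partitions_ge2_rec (T : finType) (D : {set T}) k x :
    x \notin D ->
  #|partitions_ge2 (x |: D) k.+1| =
  k.+1 * #|partitions_ge2 D k.+1| + \sum_(y in D) #|partitions_ge2 (D :\ y) k|.
Proof.
move=> xD; rewrite -(partitions_ge2_large _ xD).
rewrite -(eq_bigr _ (fun y yD => partitions_ge2_pair k xD yD)).
set G := partitions_ge2 _ _.
under [X in _ + X]eq_bigr => y _ do rewrite -sum1dep_card big_mkcondr /=.
rewrite exchange_big /= -[LHS]sum1_card -[X in _ = X + _]sum1dep_card.
rewrite [X in _ = X + _]big_mkcondr -big_split /=; apply: eq_bigr => P.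
rewrite inE => /and3P[pP _ /forall_inP gP].
have xP : x \in cover P by rewrite (cover_partition pP) setU11.
have PxP := pblock_mem xP; have xPx : x \in pblock P x by rewrite mem_pblock.
have tP := partition_trivIset pP.
have [lP|] := ltnP.
  rewrite big1 // => y _; case: ifP => // /(def_pblock tP)/(_ (set21 x y)) e.
  by move: lP; rewrite e cards2; case: (_ != _).
move=> le2; have /eqP/cards2P[a [b [nab eab]]] : #|pblock P x| = 2.
  by apply/eqP; rewrite eqn_leq le2 gP.
have [y nyx ey] : exists2 y, y != x & pblock P x = [set x; y].
  move: xPx; rewrite eab => /set2P[->|->]; [exists b|exists a] => //.
    by rewrite eq_sym.
  by rewrite setUC.
have yD : y \in D.
  have /subsetP/(_ y) := partitionS pP PxP.
  by rewrite ey !inE eqxx orbT (negbTE nyx) => /(_ isT).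
rewrite (bigD1 y) //= -ey PxP big1 ?addn0 // => z /andP[_ nzy].
case: ifP => // /(def_pblock tP)/(_ (set21 x z)); rewrite ey => /setP/(_ y).
by rewrite !inE eqxx orbT (negbTE nyx) eq_sym (negbTE nzy).
Qed.

Lemma partitions_ge2_0 (T : finType) (D : {set T}) :
  #|partitions_ge2 D 0| = (D == set0).
Proof.
have [->|nD] := eqVneq D set0.
  rewrite (_ : partitions_ge2 _ _ = [set set0]) ?cards1 //.
  apply/setP => P; rewrite !inE partition_set0 cards_eq0 andbA andbb.
  by case: eqP => // ->; apply/forall_inP => B; rewrite inE.
apply/eqP; rewrite cards_eq0; apply/eqP/setP => P; rewrite !inE cards_eq0.
apply/and3P => -[/cover_partition cP /eqP P0 _].
by case/eqP: nD; rewrite -cP P0 /cover big_set0.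
Qed.

Lemma partitions_ge2_set0 (T : finType) k :
  #|partitions_ge2 (set0 : {set T}) k| = (k == 0).
Proof.
case: k => [|k]; first by rewrite partitions_ge2_0 eqxx.
apply/eqP; rewrite cards_eq0; apply/eqP/setP => P; rewrite !inE partition_set0.
by case: eqP => //= ->; rewrite cards0.
Qed.

(** The recurrence determines the count from the cardinality, which avoids
    transporting partitions along bijections. *)
Lemma card_partitions_ge2 (T T' : finType) (D : {set T}) (D' : {set T'}) k :
  #|D| = #|D'| -> #|partitions_ge2 D k| = #|partitions_ge2 D' k|.
Proof.
move: {2}#|D| (erefl #|D|) => n; elim/ltn_ind: n D D' k => n IH D D' k cD cD'.
case: k => [|k].
  by rewrite !partitions_ge2_0 -!cards_eq0 cD'.
have [D0|[x xD]] := set_0Vmem D.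
  move: cD'; rewrite D0 cards0 => /esym/eqP; rewrite cards_eq0 => /eqP ->.
  by rewrite !partitions_ge2_set0.
have [D0|[x' xD']] := set_0Vmem D'.
  by move: cD'; rewrite D0 cards0 => /eqP; rewrite cards_eq0 => /eqP D00;
    rewrite D00 inE in xD.
rewrite -(setD1K xD) -(setD1K xD') !partitions_ge2_rec ?setD11 //.
have c1 : #|D :\ x|.+1 = n by rewrite -cD (cardsD1 x D) xD.
have c1' : #|D' :\ x'|.+1 = n by rewrite -cD cD' (cardsD1 x' D') xD'.
have e1 : #|D :\ x| = #|D' :\ x'| by apply: succn_inj; rewrite c1 c1'.
rewrite (IH _ _ _ (D' :\ x') _ (erefl _)) // -?c1 //; congr (_ + _).
have c2 (S : finType) (E : {set S}) y : y \in E -> #|E :\ y| = #|E|.-1.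
  by move=> yE; rewrite (cardsD1 y E) yE.
have key y y' : y \in D :\ x -> y' \in D' :\ x' ->
    #|partitions_ge2 (D :\ x :\ y) k| = #|partitions_ge2 (D' :\ x' :\ y') k|.
  move=> yE yE'; apply: (IH #|D :\ x|.-1); first by rewrite -c1 ltnS leq_pred.
    exact: c2.
  by rewrite (c2 _ _ _ yE) (c2 _ _ _ yE') e1.
have [E0|[y0 yE]] := set_0Vmem (D :\ x).
  have E0' : D' :\ x' = set0 by apply/eqP; rewrite -cards_eq0 -e1 E0 cards0.
  by rewrite E0 E0' !big_set0.
have [E0'|[y0' yE']] := set_0Vmem (D' :\ x').
  by move/eqP: e1; rewrite E0' cards0 cards_eq0 => /eqP E0;
    rewrite E0 inE in yE.
transitivity (\sum_(y in D :\ x) #|partitions_ge2 (D' :\ x' :\ y0') k|).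
  by apply: eq_bigr => y yy; apply: key.
rewrite sum_nat_const e1 -sum_nat_const; apply: eq_bigr => y' yy'.
by rewrite -(key y0) // (key _ y').
Qed.

Lemma stirling_partition_ge2_rec n k :
  stirling_partition_ge2 n.+1 k.+1 =
  k.+1 * stirling_partition_ge2 n k.+1 + n * stirling_partition_ge2 n.-1 k.
Proof.
rewrite /stirling_partition_ge2 -!/(partitions_ge2 _ _).
rewrite -(setD1K (in_setT (ord0 : 'I_n.+1))) partitions_ge2_rec ?setD11 //.
have c1 : #|[set: 'I_n.+1] :\ ord0| = n.
  by have := cardsD1 (ord0 : 'I_n.+1) setT; rewrite inE cardsT card_ord => -[].
rewrite (@card_partitions_ge2 _ _ _ [set: 'I_n]);
  last by rewrite c1 cardsT card_ord.
congr (_ + _); rewrite -[X in X * _]c1 -sum_nat_const; apply: eq_bigr => y yE.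
apply: card_partitions_ge2; rewrite cardsT card_ord.
have c2 : #|[set: 'I_n.+1] :\ ord0 :\ y|.+1 = n.
  by rewrite -[RHS]c1 [RHS](cardsD1 y) yE.
by rewrite -[in RHS]c2.
Qed.

Lemma stirling_partition_ge2_0 n : stirling_partition_ge2 n 0 = (n == 0).
Proof.
by rewrite /stirling_partition_ge2 -/(partitions_ge2 _ _) partitions_ge2_0
  -cards_eq0 cardsT card_ord.
Qed.

Lemma stirling_partition_ge2_lt n k :
  n < k.*2 -> stirling_partition_ge2 n k = 0.
Proof.
elim/ltn_ind: n k => -[|n] IH [|k] // lnk.
  apply: etrans (card_partitions_ge2 _ _) (partitions_ge2_set0 'I_0 k.+1).
  by rewrite cards0 cardsT card_ord.
rewrite stirling_partition_ge2_rec IH // ?muln0; last by rewrite ltnW.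
case: n IH lnk => [|n] IH lnk; first by rewrite mul0n.
by rewrite IH ?muln0 //= ltnW.
Qed.

(** * The summands as polynomials *)

Local Open Scope ring_scope.

(** The summand of index n of the cycle expansion, as a polynomial in tau.  Index
    m = 0 contributes nothing, as no permutation of n points has n + 1 cycles. *)
Definition cycle_poly (F : fieldType) (sigma : F) (n : nat) : {poly F} :=
  \poly_(m < n.+1)
    ((- sigma) ^+ (n - m) * (stirling_cycle n (n - m).+1)%:R / (m`!)%:R).

Lemma cycle_poly0 (F : fieldType) (sigma : F) : cycle_poly sigma 0 = 0.
Proof.
apply/polyP => -[|m]; rewrite coef_poly coef0 //=.
by rewrite stirling_cycle_gt // mulr0 mul0r.
Qed.

Lemma cycle_poly_horner0 (F : fieldType) (sigma : F) n :
  (cycle_poly sigma n).[0] = 0.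
Proof.
by rewrite horner_coef0 coef_poly subn0 stirling_cycle_gt // mulr0 mul0r.
Qed.

(** On the coefficient of X^m this is the recurrence for the number of
    permutations of n + 1 points with n - m + 1 cycles. *)
Lemma cycle_poly_deriv (F : numFieldType) (sigma : F) n :
  (cycle_poly sigma n.+1)^`() =
  n%:R * cycle_poly sigma n - sigma%:P * (cycle_poly sigma n)^`()
  + (n == 0%N)%:R.
Proof.
have fact_neq0 m : (m`!)%:R != 0 :> F by rewrite pnatr_eq0 -lt0n fact_gt0.
apply/polyP => m; rewrite coefD coefB mulr_natl coefMn coefCM !coef_deriv.
rewrite !coef_poly ltnS subSS -polyC_natr coefC.
have [mn|nm] := leqP m.+1 n.+1; last first.
  rewrite ltnNge (ltnW nm) /= mul0rn mulr0 !mul0rn subr0 add0r.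
  by case: m nm => // m nm.
rewrite stirling_cycle_rec ltnS factS natrM natrD natrM.
have [mn1|] := ltnP m n; last first.
  rewrite leq_eqVlt ltnNge -ltnS mn orbF => /eqP ->.
  rewrite subnn stirling_cycle0 expr0 mul0rn mulr0 subr0.
  rewrite -mulr_natr -[X in _ = X + _]mulr_natr.
  have [->|m_neq0] := eqVneq m 0%N.
    by rewrite fact0 /=; field.
  rewrite /= mulr0n; field.
  by rewrite fact_neq0 nat1r pnatr_eq0.
rewrite ?(factS, natrM).
have -> : (n - m)%N = (n - m.+1).+1 by lia.
rewrite exprS (gtn_eqF (leq_ltn_trans (leq0n m) mn1)).
rewrite [(if m == 0%N then _ else _)](_ : _ = 0) ?if_same //.
by field; rewrite ?fact_neq0 ?nat1r ?pnatr_eq0.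
Qed.

(** The summand of index n of the partition expansion without its factor
    tau^n, as a polynomial in zeta. *)
Definition partition_poly (F : fieldType) (n : nat) : {poly F} :=
  \sum_(q < n) ((-1) ^+ (q + n - 1) * (stirling_partition_ge2 (q + n - 1) q)%:R
                / (n`!)%:R) *: 'X^(q + n).

(** On X^(q + n + 2) this is the recurrence for the partitions of q + n + 1
    points into q blocks. *)
Lemma partition_poly_rec (F : numFieldType) n :
  n.+2%:R * partition_poly F n.+2 =
  n.+1%:R * 'X * partition_poly F n.+1
  - 'X^2 * (1 - 'X) * (partition_poly F n.+1)^`().
Proof.
set b := fun q => (-1) ^+ (q + n) * (stirling_partition_ge2 (q + n) q)%:R /
  (n.+1`!)%:R : F.
have fact_neq0 m : (m`!)%:R != 0 :> F by rewrite pnatr_eq0 -lt0n fact_gt0.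
have bn : b n.+1 = 0.
  by rewrite /b stirling_partition_ge2_lt ?mulr0 ?mul0r //; lia.
(* No partition of 2 n + 1 points into n + 1 blocks of size at least 2: the sum
   may be extended by one term to align the two shifted sums. *)
have pE : partition_poly F n.+1 = \sum_(q < n.+2) b q *: 'X^(q + n.+1).
  rewrite big_ord_recr /= bn scale0r addr0 /partition_poly.
  by apply: eq_bigr => q _; rewrite addnS subn1.
have pE' : partition_poly F n.+1 = \sum_(q < n.+1) b q *: 'X^(q + n.+1).
  by rewrite pE big_ord_recr /= bn scale0r addr0.
have d k : 'X * ('X^(k + n.+1) : {poly F})^`() = (k + n.+1)%:R *: 'X^(k + n.+1).
  by rewrite addnS derivXn mulrnAr -exprS scaler_nat.
have -> : n.+1%:R * 'X * partition_poly F n.+1 -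
    'X^2 * (1 - 'X) * (partition_poly F n.+1)^`() =
  'X * (n.+1%:R * partition_poly F n.+1 - 'X * (partition_poly F n.+1)^`())
  + 'X^2 * ('X * (partition_poly F n.+1)^`()) by ring.
have -> : n.+1%:R * partition_poly F n.+1 - 'X * (partition_poly F n.+1)^`() =
    \sum_(q < n.+2) (- q%:R * b q) *: 'X^(q + n.+1).
  rewrite pE raddf_sum /= !big_distrr -sumrB; apply: eq_bigr => q _ /=.
  rewrite derivZ -[X in _ - X]scalerAr d mulr_natl -scaler_nat !scalerA
    -scalerBl natrD.
  by congr (_ *: _); ring.
have -> : 'X * (partition_poly F n.+1)^`() =
    \sum_(q < n.+1) ((q + n.+1)%:R * b q) *: 'X^(q + n.+1).
  rewrite pE' raddf_sum /= big_distrr; apply: eq_bigr => q _ /=.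
  by rewrite derivZ -scalerAr d scalerA mulrC.
rewrite !big_distrr /= [X in X + _]big_ord_recl /= oppr0 mul0r scale0r mulr0
  add0r.
rewrite -big_split /= big_ord_recl add0n stirling_partition_ge2_0 subn1 /=.
rewrite mulr0 mul0r scale0r mulr0 add0r; apply: eq_bigr => q _ /=.
rewrite mulr_natl -scaler_nat scalerA -!scalerAr -exprS -exprD.
have -> : (bump 0 q + n.+1).+1 = (bump 0 q + n.+2)%N by lia.
have -> : (2 + (q + n.+1))%N = (bump 0 q + n.+2)%N by rewrite /bump; lia.
rewrite -scalerDl; congr (_ *: _).
have -> : (bump 0 q + n.+2 - 1)%N = (q + n).+2 by rewrite /bump; lia.
rewrite /b [(n.+2)`!]factS natrM; move: (fact_neq0 n.+1).
set f := (n.+1`!)%:R => f_neq0.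
rewrite /bump add1n addSn stirling_partition_ge2_rec /=.
rewrite natrD !natrM !exprS !natrD.
by field; rewrite f_neq0 -natrD pnatr_eq0.
Qed.

Lemma partition_poly1 (F : numFieldType) : partition_poly F 1 = 'X.
Proof.
rewrite /partition_poly big_ord1 /= stirling_partition_ge2_0 expr0 mul1r.
by rewrite divr1 scale1r.
Qed.

Lemma partition_poly0 (F : fieldType) : partition_poly F 0 = 0.
Proof. by rewrite /partition_poly big_ord0. Qed.

Local Close Scope ring_scope.

(** * Convergence at the boundary *)

Local Open Scope R_scope.

Lemma ex_series_bounded (a : nat -> R) :
  ex_series a -> exists M, forall n, Rabs (a n) <= M.
Proof.
move=> /ex_series_lim_0 la.
have [|M HM] := filterlim_bounded a; first by exists 0.
by exists M.
Qed.

Lemma ex_series_CV_radius (a : nat -> R) :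
  ex_series a -> Rbar_le 1 (CV_radius a).
Proof.
move=> /ex_series_bounded [M HM]; have [ub _] := CV_radius_bounded a.
by apply: ub; exists M => n; rewrite pow1 Rmult_1_r.
Qed.

(** Convergence at 1 bounds the radius below by 1; Abel's theorem is needed when
    the radius is exactly 1, and continuity suffices otherwise. *)
Lemma abel_at_1 (a : nat -> R) :
  ex_series a -> filterlim (PSeries a) (at_left 1) (locally (Series a)).
Proof.
move=> ca; have ra := ex_series_CV_radius ca.
have e1 : PSeries a 1 = Series a.
  by apply: Series_ext => n; rewrite pow1 Rmult_1_r.
rewrite -e1; have [lt1|] := Rbar_lt_dec 1 (CV_radius a).
  apply: (filterlim_filter_le_1 (F := locally 1));
    first exact: filter_le_within.
  apply/continuity_pt_filterlim; apply: PSeries_continuity.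
  by rewrite Rabs_pos_eq //; lra.
move=> /Rbar_not_lt_le ra'; have r1 : CV_radius a = 1 by apply: Rbar_le_antisym.
have := @Abel a; rewrite r1; apply=> //=; first lra.
by apply: ex_series_ext ca => n;
  rewrite pow_n_pow pow1 /scal /= /mult /= Rmult_1_l.
Qed.

(** The hypothesis is e' = - a' e for the sums on [0, 1), so e exp(a) keeps
    its value 1 at 0; both sums then pass to the limit at 1. *)
Lemma Series_exp_opp (a e : nat -> R) :
    ex_series a -> ex_series e -> a 0%N = 0 -> e 0%N = 1 ->
    (forall n, PS_derive e n + PS_mult (PS_derive a) e n = 0) ->
  Series e = exp (- Series a).
Proof.
move=> ca ce a0 e0 rel.
have in_disk b t : ex_series b -> 0 <= t < 1 -> Rbar_lt (Rabs t) (CV_radius b).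
  move=> cb ht; apply: Rbar_lt_le_trans (ex_series_CV_radius cb).
  by rewrite /= Rabs_pos_eq; lra.
have onI t : 0 <= t < 1 -> PSeries e t = exp (- PSeries a t).
  move=> ht.
  pose g t := PSeries e t * exp (PSeries a t).
  have dg s : 0 <= s <= t -> is_derive g s zero.
    move=> hs; have hs1 : 0 <= s < 1 by lra.
    have da := is_derive_PSeries a s (in_disk _ _ ca hs1).
    have de := is_derive_PSeries e s (in_disk _ _ ce hs1).
    have ode : PSeries (PS_derive e) s = - (PSeries (PS_derive a) s * PSeries e
      s).
      rewrite -PSeries_mult ?CV_radius_derive; try exact: in_disk.
      rewrite -PSeries_opp; apply: PSeries_ext => n.
      by rewrite /PS_opp /Hierarchy.opp /=; have := rel n; lra.
    rewrite /g.
    have -> : zero = PSeries (PS_derive e) s * exp (PSeries a s) +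
      PSeries e s * (PSeries (PS_derive a) s * exp (PSeries a s)).
      by rewrite ode /zero /=; lra.
    have dx := is_derive_comp exp (PSeries a) s _ _ (is_derive_exp _) da.
    exact: (is_derive_mult (PSeries e) (fun x =>
      exp (PSeries a x)) s _ _ de dx Rmult_comm).
  have g0 : g 0 = 1 by rewrite /g !PSeries_0 a0 e0 exp_0 Rmult_1_l.
  have gt : g t = 1.
    case: (Req_dec t 0) => [->//|tn0].
    by rewrite -g0; apply/esym/(eq_is_derive _ _ _ dg); lra.
  rewrite exp_Ropp; apply: (Rmult_eq_reg_r (exp (PSeries a t))).
    by rewrite Rinv_l //; have := exp_pos (PSeries a t); lra.
  by have := exp_pos (PSeries a t); lra.
apply: (filterlim_locally_unique (F := at_left 1) (PSeries e));
  first exact: abel_at_1.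
apply: (filterlim_ext_loc (fun t => exp (- PSeries a t))).
  exists (mkposreal 1 Rlt_0_1) => t /= bt lt1; apply/esym/onI.
  by move: bt => /Rabs_def2; rewrite /minus /plus /Hierarchy.opp /=; lra.
apply: (filterlim_comp _ _ _ (PSeries a) (fun y => exp (- y))
  _ _ _ (abel_at_1 ca)).
by apply: (ex_derive_continuous (fun y => exp (- y))); auto_derive.
Qed.

Local Close Scope R_scope.

(** * The fundamental relation and the two solutions *)

Local Open Scope ring_scope.

(** Substituting t by a multiple of t, and multiplying e by a constant, preserve the
    differential equation. *)
Lemma fps_exp_opp_scale (A : comNzRingType) (a e : nat -> A) (c t : A) :
  fps_exp_opp a e ->
  fps_exp_opp (fun n => a n * t ^+ n) (fun n => c * e n * t ^+ n).
Proof.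
move=> ae n; rewrite -[RHS](mulr0 (c * t ^+ n)) -(ae n) mulrDr /fps_mul
  big_distrr.
congr (_ + _); first by rewrite /fps_theta; ring.
apply: eq_bigr => k _; rewrite /fps_theta /=.
have -> : t ^+ n = t ^+ k * t ^+ (n - k) by rewrite -exprD subnKC // -ltnS.
ring.
Qed.

Lemma fps_exp_opp_horner (R : comNzRingType) (a e : nat -> {poly R}) (x : R) :
  fps_exp_opp a e -> fps_exp_opp (fun n => (a n).[x]) (fun n => (e n).[x]).
Proof.
move=> ae n; have := congr1 (fun p : {poly R} => p.[x]) (ae n).
rewrite hornerD fps_mul_horner horner0 /fps_theta.
have th (f : nat -> {poly R}) k : (k%:R * f k).[x] = k%:R * (f k).[x].
  by rewrite -polyC_natr hornerM hornerC.
by rewrite th => <-; congr (_ + _); apply: eq_bigr => k _; rewrite th.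
Qed.

Lemma fps_exp_opp_ext (A : pzSemiRingType) (a e e' : nat -> A) :
  e =1 e' -> fps_exp_opp a e -> fps_exp_opp a e'.
Proof.
move=> ee' ae n; rewrite -[RHS](ae n) /fps_theta ee'; congr (_ + _).
by apply: fps_mul_ext => // k; rewrite ee'.
Qed.

Lemma fps_exp_opp_PS (a e : nat -> R) : fps_exp_opp a e ->
  forall n, PS_derive e n + PS_mult (PS_derive a) e n = 0.
Proof.
move=> ae n; rewrite -(ae n.+1) /fps_mul big_ord_recl /fps_theta mul0r mul0r
  add0r.
rewrite /PS_mult sum_f_R0E big_mkord /PS_derive INRE.
by congr (_ + _); apply: eq_bigr => k _; rewrite INRE.
Qed.

Lemma sum_n_mE (f : nat -> R) m n : (m <= n.+1)%N ->
  sum_n_m f m n = \sum_(m <= k < n.+1) f k.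
Proof.
elim: n => [|n IH] lmn.
  case: m lmn => [|[|m]] // _; first by rewrite sum_n_n big_nat1.
  by rewrite sum_n_m_zero // big_geq.
move: lmn; rewrite leq_eqVlt => /orP[/eqP ->|lmn].
  by rewrite sum_n_m_zero ?big_geq //; apply/ltP.
rewrite sum_n_Sm; last exact/leP.
by rewrite IH // [RHS]big_nat_recr.
Qed.

Lemma u_term_cycleE (sigma tau : R) n :
  u_term cycle_expansion sigma tau n = (cycle_poly sigma n).[tau].
Proof.
rewrite /u_term sum_n_mE // horner_poly big_ord_recl /= subn0.
rewrite stirling_cycle_gt // mulr0 mul0r mul0r add0r.
rewrite big_add1 big_mkord; apply: eq_bigr => m _.
rewrite !RpowE !INRE addn1 RdivE !RmultE /bump /= add1n.
rewrite -[in RHS]mulN1r exprMn; ring.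
Qed.

Lemma u_term_partitionE (sigma tau : R) n :
  u_term partition_expansion sigma tau n.+1 =
  (partition_poly R n.+1).[(1 + sigma)^-1] * tau ^+ n.+1.
Proof.
rewrite /u_term sum_n_mE // horner_sum big_mkord big_distrl /= subn1.
apply: eq_bigr => q _.
rewrite !RpowE !INRE RdivE !RmultE hornerZ hornerXn -[Rinv _]/((1 + sigma)^-1).
have -> : IZR (-1) = -1 by [].
by rewrite [_ ^+ n.+1]exprS; ring.
Qed.

Lemma is_series_fundamental (sigma tau S : R) (b : nat -> R) :
  is_series b S ->
  is_series (fun n => (n == 0%N)%:R - (n == 1%N)%:R * tau + sigma * b n)
            (1 - tau + sigma * S).
Proof.
move=> /(is_series_scal sigma) bS.
have two_gt0 : (0 < 2)%coq_nat by apply/ltP.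
apply: (is_series_decr_n _ 2) => //.
apply: (is_series_ext (fun k => scal sigma (b (2 + k)%N))) => [k|].
  by rewrite /= mul0r subrr add0r.
apply: (is_series_incr_n (fun k => scal sigma (b k)) 2) => //.
set l := (X in is_series _ X); suff -> : l = scal sigma S by [].
rewrite /l /= !sum_Sn !sum_O /plus /Hierarchy.opp /scal /= /mult /=.
rewrite !(RplusE, RoppE, RmultE).
ring.
Qed.

(** For cycle numbers sigma is scaled together with tau, so b is t a; for
    partitions sigma is a fixed parameter and b is a.  In both cases b has the sum
    u, so that e has the sum 1 - tau + sigma u. *)
Lemma u_converges_exp_opp (e : expansion) (sigma tau : R) :
    1 + sigma <> 0 -> u_converges e sigma tau ->
  exists a b : nat -> R,
    [/\ a 0%N = 0, b 0%N = 0,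
     fps_exp_opp a (fun n => (n == 0%N)%:R - (n == 1%N)%:R * tau + sigma * b n),
     is_series a (u e sigma tau) & is_series b (u e sigma tau)].
Proof.
move=> hs cu; have su := Series_correct _ cu; rewrite -/(u e sigma tau) in su.
have ser0 (f : nat -> R) S :
    f 0%N = 0 -> is_series (fun n => f n.+1) S -> is_series f S.
  move=> f0 fS; apply: is_series_decr_1; rewrite f0.
  by rewrite (_ : plus S _ = S) // /plus /Hierarchy.opp /= RplusE RoppE subr0.
case: e cu su => cu su.
  pose a n := (cycle_poly sigma n).[tau].
  have a0 : a 0%N = 0 by rewrite /a cycle_poly0 horner0.
  have aS : is_series a (u cycle_expansion sigma tau).
    by apply: ser0 a0 _; apply: is_series_ext su => n; apply: u_term_cycleE.
  exists a, (fps_shift a); split=> //; last exact: ser0.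
  have := cycle_exp_opp (cycle_poly0 sigma) (cycle_poly_horner0 sigma)
    (cycle_poly_deriv sigma).
  move=> /(fps_exp_opp_horner tau); apply: fps_exp_opp_ext => n.
  rewrite !(hornerD, hornerN, hornerM, hornerC, hornerX, hornerMn).
  by case: n => [|[|n]] /=; rewrite ?horner0 ?hornerC.
pose zeta := (1 + sigma)^-1.
have hz : zeta != 0 by rewrite invr_eq0; apply/eqP.
pose a n := (partition_poly R n).[zeta] * tau ^+ n.
have a0 : a 0%N = 0 by rewrite /a partition_poly0 horner0 mul0r.
have aS : is_series a (u partition_expansion sigma tau).
  by apply: ser0 a0 _; apply: is_series_ext su => n; apply: u_term_partitionE.
exists a, a; split=> //.
have := partition_exp_opp (partition_poly0 R) (partition_poly1 R)
  (@partition_poly_rec R).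
move=> /(fps_exp_opp_horner zeta) /(fps_exp_opp_scale zeta^-1 tau).
apply: fps_exp_opp_ext => n.
rewrite !(hornerD, hornerN, hornerM, hornerC, hornerX, hornerMn).
rewrite /a; have -> : sigma = zeta^-1 - 1 by rewrite invrK addrC addKr.
case: n => [|[|n]]; last by rewrite /=; field.
  by rewrite partition_poly0 horner0 !mul0r /=; field.
by rewrite partition_poly1 hornerX /= expr1; field.
Qed.

Local Close Scope ring_scope.
Local Open Scope R_scope.

Lemma fundamental_relation (e : expansion) (sigma tau : R) :
  1 + sigma <> 0 -> u_converges e sigma tau ->
  exp (- u e sigma tau) = 1 - tau + sigma * u e sigma tau.
Proof.
move=> hs cu; have [a [b [a0 b0 ab aS bS]]] := u_converges_exp_opp hs cu.
have eS := is_series_fundamental (sigma := sigma) (tau := tau) bS.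
have := Series_exp_opp _ _ a0 _ (fps_exp_opp_PS ab).
rewrite (is_series_unique _ _ aS) => <-.
- exact: is_series_unique eS.
- by exists (u e sigma tau).
- by eexists; exact: eS.
- by rewrite b0 mulr0 mul0r subr0 addr0.
Qed.

Theorem theorem22 (e : expansion) (alpha p x z : R)
    (halpha : 0 < alpha) (hz : 0 < z) (hx : 1 < x)
    (hxz : x = Rpower (alpha * z) alpha) (halphap : alpha = exp p) :
  sigma_untransformed alpha x = sigma_transformed p z /\
  tau_untransformed alpha x = tau_transformed p z /\
  Phi e alpha x = alpha * W_series e p z /\
  (u_converges e (sigma_untransformed alpha x) (tau_untransformed alpha x) ->
   solves_equation alpha x (Phi e alpha x) /\
   LambertW0 z = W_series e p z /\
   Phi e alpha x = alpha * LambertW0 z).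
Proof.
set l := p + ln z.
have ln_alpha : ln alpha = p by rewrite halphap ln_exp.
have lnx : ln x = alpha * l.
  by rewrite hxz /Rpower ln_exp ln_mult // ln_alpha.
have l_gt0 : 0 < l.
  apply: (Rmult_lt_reg_l alpha) => //.
  by rewrite -lnx Rmult_0_r -ln_1; apply: ln_increasing; lra.
have alpha_neq0 : alpha <> 0 by lra.
have l_neq0 : l <> 0 by lra.
have sE : sigma_untransformed alpha x = sigma_transformed p z.
  rewrite /sigma_untransformed /sigma_transformed -/l lnx.
  rewrite /Rdiv Rinv_mult -Rmult_assoc Rinv_r //.
have tE : tau_untransformed alpha x = tau_transformed p z.
  rewrite /tau_untransformed /tau_transformed -/l lnx ln_mult // ln_alpha.
  rewrite /Rdiv Rinv_mult (Rmult_comm (/ alpha)) -!Rmult_assoc Rmult_assoc.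
  by rewrite -Rmult_assoc Rmult_comm -!Rmult_assoc Rinv_l // Rmult_1_l.
have sL : sigma_transformed p z * l = 1.
  by rewrite /sigma_transformed -/l /Rdiv Rmult_1_l Rinv_l.
have s_gt0 : 0 < sigma_transformed p z
  by apply: Rdiv_lt_0_compat l_gt0; lra.
have tL : tau_transformed p z * l = p + ln l.
  by rewrite /tau_transformed -/l /Rdiv Rmult_assoc Rinv_l // Rmult_1_r.
have WE : Phi e alpha x = alpha * W_series e p z.
  rewrite /Phi /W_series sE tE -/l; congr (_ * (_ + _)).
  apply: (Rmult_eq_reg_r (sigma_transformed p z)); last by lra.
  rewrite /Rdiv Rmult_assoc Rinv_l; last by lra.
  have -> : ln z - ln l = l - tau_transformed p z * l by rewrite tL /l; lra.
  by rewrite -[X in _ * X = _]sL; lra.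
split=> //; split=> //; split=> // cu.
have W_exp : W_series e p z =
    l * exp (- u e (sigma_transformed p z) (tau_transformed p z)).
  rewrite -sE -tE fundamental_relation //; last by rewrite sE; lra.
  rewrite sE tE /W_series -/l; set v := u _ _ _.
  have -> : ln z - ln l = l - tau_transformed p z * l by rewrite tL /l; lra.
  have : sigma_transformed p z * l * v = v by rewrite sL Rmult_1_l.
  lra.
have W_gt0 : 0 < W_series e p z.
  by rewrite W_exp; apply: Rmult_lt_0_compat (exp_pos _).
(* Both w exp(w) = z and y^alpha exp(y) = x are exponentials of multiples of
   this identity, up to the term alpha p. *)
have lnW : ln (W_series e p z) + W_series e p z = ln z.
  rewrite [in ln _]W_exp ln_mult //; last exact: exp_pos.
  by rewrite ln_exp /W_series -/l; lra.
have LW : LambertW0 z = W_series e p z.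
  apply: LambertW0_unique; first lra.
  by rewrite -[X in X * _](exp_ln _ W_gt0) -exp_plus lnW exp_ln.
split; last by rewrite LW WE.
split; rewrite WE; first exact: Rmult_lt_0_compat.
rewrite hxz /Rpower -exp_plus !ln_mult // -lnW; congr exp; lra.
Qed.
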